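(* Let $m\ge n\ge 1$ and let $X,Y\in \mathsf{M}_{m\times n}(\mathbb{C})$ be nonzero. The Normal Procrustes Problem of determining $$A^\star\in \operatorname*{argmin}_{A\in\mathcal{N}}\ \|AX-Y\|_F^2$$ is equivalent to determining $$U^\star\in\operatorname*{argmax}_{U\in \mathrm{U}(m)} f(U),$$ where $$f(U)=\sum_{i=1}^m \frac{|\gamma_i|^2}{\phi_i}=\sum_{i=1}^m |d_i^\star|^2\phi_i=\|D_U^\star U^*X\|_F^2,$$ with the convention that the $i$th term equals zero when $(U^*X)_i=0$. An optimal $A^\star = U^\star D^\star_{U^\star}(U^\star)^*$ is normal, where $D_U^\star=\operatorname{diag}(d_1^\star,\dots,d_m^\star)$.
   Context: $\mathsf{M}_{m\times n}(\mathbb{C})$ is the set of complex $m\times n$ matrices and $\mathsf{M}_m(\mathbb{C})=\mathsf{M}_{m\times m}(\mathbb{C})$. $\|\cdot\|_F$ is the Frobenius norm, and $^*$ on a matrix denotes the conjugate transpose (the superscript $\star$ marks optimal quantities). $\mathcal{N}=\{B\in\mathsf{M}_m(\mathbb{C}) : B^*B=BB^*\}$ is the set of normal matrices and $\mathrm{U}(m)$ is the set of unitary $m\times m$ matrices. The argmin over $\mathcal{N}$ may be empty; it is not asserted that the infimum is attained. For a matrix $M$, $(M)_i$ denotes its $i$th row (a row vector). For fixed $X,Y$ and $U\in\mathrm{U}(m)$, define, for $i=1,\dots,m$ (dependence on $U$ is suppressed in the notation), $$\phi_i:=\|(U^*X)_i\|_F^2,\qquad \gamma_i:=(U^*Y)_i\,(U^*X)_i^*,$$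 $$d_i^\star:=\begin{cases}\gamma_i/\phi_i & \text{if }(U^*X)_i\neq 0,\\ 0&\text{if }(U^*X)_i=0,\end{cases}\qquad D_U^\star:=\operatorname{diag}(d_1^\star,\dots,d_m^\star).$$ For fixed $U$, the matrix $D_U^\star$ is a global minimizer of $\|UDU^*X-Y\|_F^2$ over complex diagonal matrices $D$. *)

(* Defs.v *)
From mathcomp Require Import all_boot all_order all_algebra.
From mathcomp Require Import sesquilinear spectral complex reals.

Set Implicit Arguments.
Unset Strict Implicit.
Unset Printing Implicit Defensive.

Import Order.TTheory GRing.Theory Num.Theory.
Local Open Scope ring_scope.
Local Open Scope sesquilinear_scope.
Local Open Scope complex_scope.

(* The field of complex numbers is R[i] with R : realType.  The order and the
   norm of R[i] take values in R[i]; the real-valued modulus is normc, so that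
   norms and objective functions below live in the ordered field R. *)

Definition is_argmin (R : realType) (T : Type) (S : T -> Prop) (g : T -> R)
    (x : T) : Prop :=
  S x /\ forall y, S y -> g x <= g y.

Definition is_argmax (R : realType) (T : Type) (S : T -> Prop) (g : T -> R)
    (x : T) : Prop :=
  S x /\ forall y, S y -> g y <= g x.

Definition frobenius (R : realType) (m n : nat) (M : 'M[R[i]]_(m, n)) : R :=
  Num.sqrt (\sum_(i < m) \sum_(j < n) Normc.normc (M i j) ^+ 2).

Section Procrustes.
Variables (R : realType) (m n : nat).
Implicit Types (X Y : 'M[R[i]]_(m, n)) (U A : 'M[R[i]]_m) (i : 'I_m).

Definition phi X U i : R := frobenius (row i (U^t* *m X)) ^+ 2.

(* A row times the conjugate transpose of a row is a 1 x 1 matrix; gamma is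
   its only entry. *)
Definition gamma X Y U i : R[i] :=
  (row i (U^t* *m Y) *m (row i (U^t* *m X))^t*) ord0 ord0.

Definition dstar X Y U i : R[i] :=
  if row i (U^t* *m X) == 0 then 0 else gamma X Y U i / (phi X U i)%:C.

Definition Dstar X Y U : 'M[R[i]]_m := diag_mx (\row_i dstar X Y U i).

Definition fobj X Y U : R :=
  \sum_(i < m)
    (if row i (U^t* *m X) == 0 then 0
     else Normc.normc (gamma X Y U i) ^+ 2 / phi X U i).

Definition Astar X Y U : 'M[R[i]]_m := U *m Dstar X Y U *m U^t*.

Definition NPP_solution X Y : 'M[R[i]]_m -> Prop :=
  is_argmin (fun A => A \is normalmx) (fun A => frobenius (A *m X - Y) ^+ 2).

Definition fobj_maximizer X Y : 'M[R[i]]_m -> Prop :=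
  is_argmax (fun U => U \is unitarymx) (fobj X Y).

End Procrustes.

(* Main.v *)
Require Import Defs.
From mathcomp Require Import all_boot all_order all_algebra.
From mathcomp Require Import sesquilinear spectral complex reals.
From mathcomp Require Import ring.

Import Order.TTheory GRing.Theory Num.Theory.
Local Open Scope ring_scope.
Local Open Scope sesquilinear_scope.
Local Open Scope complex_scope.

(** For a fixed unitary U, the normal matrices with eigenbasis U are the
    U D U^* with D diagonal, and by the spectral theorem every normal matrix
    has this form for some U.  The Frobenius norm is unitarily invariant, so
    |U D U^* X - Y| = |D (U^* X) - U^* Y|, and the diagonal D acts on each row
    separately: the problem splits into m scalar least squares problems, one
    for each pair of rows x, y of U^* X and U^* Y.  Completing the square in
    each of them (row_least_squares) and summing gives (residual_split)

      |U D U^* X - Y|^2 = |Y|^2 - f(U) + sum_i phi_i |d_i - d_i^*|^2.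

    The last sum is nonnegative and vanishes at D = D_U^*.  So each unitary U
    yields the candidate U D_U^* U^*, which is normal with residual
    |Y|^2 - f(U), and every other normal matrix with eigenbasis U has at least
    this residual.  Minimizing over normal matrices is therefore the same as
    maximizing f over unitary U. *)

Lemma unitary_mulKmx {C : numClosedFieldType} {m n : nat} (U : 'M[C]_m)
    (B : 'M[C]_(m, n)) :
  U \is unitarymx -> U^t* *m (U *m B) = B.
Proof. by move=> Uu; rewrite -(invmx_unitary Uu) mulKmx ?unitarymx_unit. Qed.

Lemma normc_sqC {R : realType} (z : R[i]) :
  (Normc.normc z ^+ 2)%:C = z * Num.conj z.
Proof. by rewrite rmorphXn /= -normCK. Qed.

(** The trace form lives in the complex field, where unitary invariance and
    expansions of differences are ring identities. *)
Lemma frobenius_sqC {R : realType} {m n : nat} (M : 'M[R[i]]_(m, n)) :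
  (frobenius M ^+ 2)%:C = \tr (M *m M^t*).
Proof.
rewrite /frobenius sqr_sqrtr; last first.
  by apply: sumr_ge0 => i _; apply: sumr_ge0 => j _; rewrite sqr_ge0.
rewrite rmorph_sum; apply: eq_bigr => i _; rewrite rmorph_sum mxE.
by apply: eq_bigr => j _; rewrite !mxE; exact: normc_sqC.
Qed.

Lemma frobenius_sq_rows {R : realType} {m n : nat} (M : 'M[R[i]]_(m, n)) :
  frobenius M ^+ 2 = \sum_i frobenius (row i M) ^+ 2.
Proof.
apply: complexI; rewrite frobenius_sqC rmorph_sum; apply: eq_bigr => i _.
rewrite /= frobenius_sqC /mxtrace big_ord1 !mxE.
by apply: eq_bigr => j _; rewrite !mxE.
Qed.

Lemma frobenius_unitaryl {R : realType} {m n : nat} (U : 'M[R[i]]_m)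
    (M : 'M[R[i]]_(m, n)) :
  U \is unitarymx -> frobenius (U *m M) ^+ 2 = frobenius M ^+ 2.
Proof.
move=> Uu; apply: complexI; rewrite !frobenius_sqC trmx_mul map_mxM.
by rewrite mulmxA mxtrace_mulC -mulmxA (unitary_mulKmx _ _ Uu).
Qed.

Lemma frobenius_sqZ {R : realType} {m n : nat} (d : R[i])
    (M : 'M[R[i]]_(m, n)) :
  frobenius (d *: M) ^+ 2 = Normc.normc d ^+ 2 * frobenius M ^+ 2.
Proof.
apply: complexI; rewrite [RHS]rmorphM /= !frobenius_sqC normc_sqC.
by rewrite linearZ map_mxZ /= -scalemxAl -scalemxAr !mxtraceZ mulrA.
Qed.

Lemma frobenius_sq_gt0 {R : realType} {m n : nat} (M : 'M[R[i]]_(m, n)) :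
  M != 0 -> 0 < frobenius M ^+ 2.
Proof.
move=> M0; rewrite lt_def sqr_ge0 andbT; apply: contraNneq M0.
rewrite sqr_sqrtr => [F0|]; last first.
  by apply: sumr_ge0 => i _; apply: sumr_ge0 => j _; rewrite sqr_ge0.
apply/eqP/matrixP => i j; rewrite mxE; apply: Normc.eq0_normc.
have row_ge0 k : 0 <= \sum_l Normc.normc (M k l) ^+ 2.
  by apply: sumr_ge0 => l _; rewrite sqr_ge0.
have /eqP := F0; rewrite psumr_eq0 // => /allP /(_ i (mem_index_enum _)) /=.
rewrite psumr_eq0 => [|l _]; last exact: sqr_ge0.
by move=> /allP /(_ j (mem_index_enum _)); rewrite /= sqrf_eq0 => /eqP.
Qed.

(** Completing the square in d.  The optimal d is g / p, the coefficient of
    the orthogonal projection of y on the line spanned by x, and the removed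
    amount |g|^2 / p is the squared length of that projection. *)
Lemma row_least_squares {R : realType} {n : nat} (x y : 'rV[R[i]]_n)
    (d : R[i]) (g := (y *m x^t*) ord0 ord0) (p := frobenius x ^+ 2) :
  x != 0 ->
  frobenius (d *: x - y) ^+ 2 =
    frobenius y ^+ 2 - Normc.normc g ^+ 2 / p
    + p * Normc.normc (d - g / p%:C) ^+ 2.
Proof.
move=> x0; have p0 : p%:C != 0.
  by rewrite (inj_eq (@complexI R) _ 0) gt_eqF ?frobenius_sq_gt0.
have pE : (x *m x^t*) ord0 ord0 = p%:C.
  by rewrite frobenius_sqC /mxtrace big_ord1.
have yxE : (x *m y^t*) ord0 ord0 = Num.conj g.
  rewrite /g !mxE rmorph_sum; apply: eq_bigr => k _.
  by rewrite !mxE rmorphM /= conjCK mulrC.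
have pJ : Num.conj p%:C = p%:C.
  by apply/CrealP; apply/complex_realP; exists p.
have expand : ((d *: x - y) *m (d *: x - y)^t*) ord0 ord0 =
    d * Num.conj d * p%:C - d * Num.conj g - Num.conj d * g
    + (y *m y^t*) ord0 ord0.
  rewrite -pE -yxE /g !mxE !mulr_sumr -!sumrB -big_split.
  by apply: eq_bigr => k _; rewrite !mxE rmorphB rmorphM /=; ring.
have castE (a b c q : R) :
    (a - b / q + q * c)%:C = a%:C - b%:C / q%:C + q%:C * c%:C.
  by rewrite rmorphD rmorphB !rmorphM fmorphV.
apply: complexI; rewrite castE !normc_sqC rmorphB fmorph_div /= pJ.
rewrite (frobenius_sqC (d *: x - y)) (frobenius_sqC y) /mxtrace !big_ord1.
by rewrite expand; field.
Qed.

Lemma fobjE {R : realType} {m n : nat} (X Y : 'M[R[i]]_(m, n))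
    (U : 'M[R[i]]_m) :
  fobj X Y U = \sum_i Normc.normc (dstar X Y U i) ^+ 2 * phi X U i.
Proof.
apply: eq_bigr => i _; rewrite /dstar; case: ifPn => [_|x0].
  by rewrite Normc.normc0 expr0n mul0r.
have p0 : 0 < phi X U i by rewrite /phi frobenius_sq_gt0.
rewrite Normc.normcM Normc.normcV.
have -> : Normc.normc (phi X U i)%:C = phi X U i.
  by rewrite /= expr0n addr0 sqrtr_sqr ger0_norm ?ltW.
by field; rewrite gt_eqF.
Qed.

Lemma fobj_frobenius {R : realType} {m n : nat} (X Y : 'M[R[i]]_(m, n))
    (U : 'M[R[i]]_m) :
  \sum_i Normc.normc (dstar X Y U i) ^+ 2 * phi X U i =
  frobenius (Dstar X Y U *m U^t* *m X) ^+ 2.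
Proof.
rewrite frobenius_sq_rows; apply: eq_bigr => i _.
by rewrite -mulmxA row_mul row_diag_mx mxE -scalemxAl -rowE frobenius_sqZ.
Qed.

(** The unitary U^* turns the residual into D (U^* X) - U^* Y without changing
    its norm or that of Y, and row_least_squares applies to each row. *)
Lemma residual_split {R : realType} {m n : nat} (X Y : 'M[R[i]]_(m, n))
    (U : 'M[R[i]]_m) (d : 'rV[R[i]]_m) :
  U \is unitarymx ->
  frobenius (U *m diag_mx d *m U^t* *m X - Y) ^+ 2 =
    frobenius Y ^+ 2 - fobj X Y U
    + \sum_i phi X U i * Normc.normc (d ord0 i - dstar X Y U i) ^+ 2.
Proof.
move=> Uu; have Vu : U^t* \is unitarymx by rewrite trmxC_unitary.
rewrite -(frobenius_unitaryl _ (_ - Y) Vu) -(frobenius_unitaryl _ Y Vu).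
rewrite mulmxBr -2!(mulmxA U) (unitary_mulKmx _ _ Uu) -mulmxA.
rewrite [in LHS]frobenius_sq_rows [in RHS]frobenius_sq_rows.
rewrite -sumrB -big_split; apply: eq_bigr => i _ /=.
rewrite linearB /= row_mul row_diag_mx -scalemxAl -rowE /dstar /gamma /phi.
case: eqP => [->|/eqP x0]; last exact: row_least_squares.
(* A vanishing row of U^* X leaves the row of Y as residual, whatever d. *)
rewrite scaler0 -[0](scale0r 0) frobenius_sqZ Normc.normc0 expr0n !mul0r.
rewrite subr0 addr0 scale0r sub0r -scaleN1r frobenius_sqZ.
by rewrite normcN Normc.normc1 expr1n mul1r.
Qed.

Lemma residual_ge {R : realType} {m n : nat} (X Y : 'M[R[i]]_(m, n))
    (U : 'M[R[i]]_m) (d : 'rV[R[i]]_m) :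
  U \is unitarymx ->
  frobenius Y ^+ 2 - fobj X Y U <=
  frobenius (U *m diag_mx d *m U^t* *m X - Y) ^+ 2.
Proof.
move=> Uu; rewrite residual_split // lerDl.
by apply: sumr_ge0 => i _; rewrite mulr_ge0 ?sqr_ge0.
Qed.

Lemma residual_Astar {R : realType} {m n : nat} (X Y : 'M[R[i]]_(m, n))
    (U : 'M[R[i]]_m) :
  U \is unitarymx ->
  frobenius (Astar X Y U *m X - Y) ^+ 2 = frobenius Y ^+ 2 - fobj X Y U.
Proof.
move=> Uu; rewrite residual_split // big1 ?addr0 // => i _.
by rewrite mxE subrr Normc.normc0 expr0n mulr0.
Qed.

Lemma residual_Astar_le {R : realType} {m n : nat} (X Y : 'M[R[i]]_(m, n))
    (U V : 'M[R[i]]_m) :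
  U \is unitarymx -> V \is unitarymx ->
  (frobenius (Astar X Y U *m X - Y) ^+ 2 <=
   frobenius (Astar X Y V *m X - Y) ^+ 2) = (fobj X Y V <= fobj X Y U).
Proof.
move=> Uu Vu; have UE := residual_Astar X Y U Uu.
have VE := residual_Astar X Y V Vu.
by rewrite (congr2 (@Order.le _ R) UE VE) lerD2l lerN2.
Qed.

Lemma unitary_diag_normal {C : numClosedFieldType} {m : nat} (U : 'M[C]_m)
    (d : 'rV[C]_m) :
  U \is unitarymx -> U *m diag_mx d *m U^t* \is normalmx.
Proof.
move=> Uu; apply/normalmxP; rewrite !trmx_mul !map_mxM trmxCK.
rewrite tr_diag_mx map_diag_mx.
by rewrite -!mulmxA !(unitary_mulKmx _ _ Uu); congr (U *m _); rewrite !mulmxA diag_mxC.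
Qed.

Lemma normal_unitary_diag {C : numClosedFieldType} {m : nat} (A : 'M[C]_m) :
  A \is normalmx ->
  exists (U : 'M[C]_m) (d : 'rV[C]_m),
    U \is unitarymx /\ A = U *m diag_mx d *m U^t*.
Proof.
move=> /orthomx_spectralP AE; have Pu := spectral_unitarymx A.
exists ((spectralmx A)^t*), (spectral_diag A); split.
  by rewrite trmxC_unitary.
by rewrite trmxCK -(invmx_unitary Pu).
Qed.

Lemma Astar_normal {R : realType} {m n : nat} (X Y : 'M[R[i]]_(m, n))
    (U : 'M[R[i]]_m) :
  U \is unitarymx -> Astar X Y U \is normalmx.
Proof. exact: unitary_diag_normal. Qed.

Theorem theorem2p2 (R : realType) (m n : nat) (hn : (1 <= n)%N)
    (hmn : (n <= m)%N) (X Y : 'M[R[i]]_(m, n)) (hX : X != 0) (hY : Y != 0) :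
  (* the three expressions of the objective function agree *)
  (forall U : 'M[R[i]]_m, U \is unitarymx ->
     fobj X Y U = \sum_(i < m) Normc.normc (dstar X Y U i) ^+ 2 * phi X U i
     /\ \sum_(i < m) Normc.normc (dstar X Y U i) ^+ 2 * phi X U i
        = frobenius (Dstar X Y U *m U^t* *m X) ^+ 2)
  (* a unitary U maximizes f iff U D_U U^* solves the Procrustes problem *)
  /\ (forall U : 'M[R[i]]_m, U \is unitarymx ->
        (fobj_maximizer X Y U <-> NPP_solution X Y (Astar X Y U)))
  (* every Procrustes solution is unitarily diagonalizable, and each of its
     unitary diagonalizations provides a maximizer of f *)
  /\ (forall A : 'M[R[i]]_m, NPP_solution X Y A ->
        (exists (U : 'M[R[i]]_m) (d : 'rV[R[i]]_m),
           U \is unitarymx /\ A = U *m diag_mx d *m U^t*)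
        /\ (forall (U : 'M[R[i]]_m) (d : 'rV[R[i]]_m),
              U \is unitarymx -> A = U *m diag_mx d *m U^t* ->
              fobj_maximizer X Y U))
  (* the solution obtained from a maximizer is normal *)
  /\ (forall U : 'M[R[i]]_m, fobj_maximizer X Y U ->
        Astar X Y U \is normalmx).
Proof.
split=> [U _|]; first by split; [exact: fobjE | exact: fobj_frobenius].
split=> [U Uu|].
  split=> [[_ Umax]|[_ Amin]].
    split=> [|A]; first exact: Astar_normal.
    rewrite (residual_Astar _ _ _ Uu) => /normal_unitary_diag [V [d [Vu ->]]].
    by apply: le_trans (residual_ge _ _ _ _ Vu); rewrite lerD2l lerN2 Umax.
  split=> [|V Vu]; first exact: Uu.
  by rewrite -(residual_Astar_le X Y _ _ Uu Vu); exact/Amin/Astar_normal.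
split=> [A [An Amin]|U [Uu _]]; last exact: Astar_normal.
split=> [|U d Uu AE]; first exact: normal_unitary_diag.
split=> [|V Vu]; first exact: Uu.
rewrite -lerN2 -(lerD2l (frobenius Y ^+ 2)).
apply: le_trans (residual_ge X Y U d Uu) _; rewrite -AE.
apply: le_trans (Amin _ (Astar_normal X Y V Vu)) _.
by rewrite (residual_Astar _ _ _ Vu).
Qed.
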